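(* Let $T$ be a rotationally uniformly ergodic operator on a complex Banach space $X$, with $\Lambda:=\sigma(T)\cap \mathbb T$ non-empty, consisting of the poles (of the resolvent of $T$) $\lambda_1,\dots,\lambda_k$. Then: (i) For every $x \in X$ and every $\lambda \in \mathbb T$ with $\bar\lambda \notin \Lambda$, the series $\sum_{n=1}^\infty \frac{\lambda^n T^n x}{n}$ converges in norm. (ii) For fixed $x \in X$, the series $\sum_{n=1}^\infty \frac{\lambda^n T^n x}{n}$ converges in norm for every $\lambda \in \mathbb T$ if and only if $x \in \bigcap_{j=1}^k (\lambda_j I-T)X$. (iii) $\big[\prod_{j=1}^k (\lambda_jI-T) \big]X$ is a closed subspace, which equals $\bigcap_{j=1}^k (\lambda_jI-T) X$.
   Context: $\mathbb T$ is the unit circle in $\mathbb C$; $\sigma(T)$ is the spectrum of $T$. A bounded operator $S$ is uniformly ergodic if $\frac1n\sum_{k=1}^nS^k$ converges in operator norm. $T$ is rotationally uniformly ergodic if $\lambda T$ is uniformly ergodic for every $\lambda\in\mathbb T$; for such $T$, the set $\sigma(T)\cap\mathbb T$ is finite and consists of simple poles of the resolvent of $T$. The points $\lambda_1,\dots,\lambda_k$ are the distinct elements of $\Lambda$. *)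

(* Defs.v *)
From HB Require Import structures.
From mathcomp Require Import all_boot all_order all_algebra.
From mathcomp Require Import all_classical all_reals all_analysis.
From mathcomp Require Export complex.

Set Implicit Arguments.
Unset Strict Implicit.
Unset Printing Implicit Defensive.
Import Order.TTheory GRing.Theory Num.Theory.
Import numFieldNormedType.Exports.

Local Open Scope classical_set_scope.
Local Open Scope ring_scope.

Section Operators.
Variables (R : realType) (X : completeNormedModType R[i]).
Implicit Types (S : X -> X) (T : {linear X -> X}) (z : R[i]).

Definition bounded_op S : Prop :=
  exists M : R[i], forall x : X, `|S x| <= M * `|x|.

(* The norm of X takes its values in R[i] (on the real axis), hence the real
   part. [sup] is the usual supremum whenever S is a bounded operator, and all
   uses below are for differences of bounded operators. *)
Definition opnorm S : R :=
  sup [set complex.Re `|S x| | x in [set x : X | `|x| <= 1]].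

Definition cesaro_mean S (n : nat) : X -> X :=
  fun x => n%:R^-1 *: \sum_(1 <= k < n.+1) iter k S x.

Definition uniformly_ergodic T : Prop :=
  bounded_op T /\
  exists2 P : {linear X -> X}, bounded_op P &
    opnorm (fun x => cesaro_mean T n x - P x) @[n --> \oo] --> (0 : R).

Definition rotationally_uniformly_ergodic T : Prop :=
  forall z, `|z| = 1 -> uniformly_ergodic (z \*: T).

Definition scalar_sub z T : X -> X := fun x => z *: x - T x.

Definition is_resolvent T z (Q : {linear X -> X}) : Prop :=
  [/\ bounded_op Q, cancel (scalar_sub z T) Q & cancel Q (scalar_sub z T)].

Definition resolvent_set T : set R[i] :=
  [set z | exists Q, is_resolvent T z Q].

Definition spectrum T : set R[i] := ~` resolvent_set T.

(* The inverse of z I - T, taken pointwise; it is the bounded inverse when z is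
   in the resolvent set, and its value elsewhere is irrelevant. *)
Definition resolvent T z : X -> X :=
  fun y => xget 0 [set x | scalar_sub z T x = y].

Definition peripheral_spectrum T : set R[i] :=
  spectrum T `&` [set z | `|z| = 1].

(* z0 is a pole of some order m > 0: the resolvent is defined on a punctured
   neighbourhood of z0 and (z - z0)^m (z I - T)^-1 has a nonzero limit A in
   operator norm as z tends to z0. The topology of the complex plane is found
   on R[i]^o, the field seen as a normed module over itself. *)
Definition resolvent_pole T (z0 : R[i]) : Prop :=
  (\forall z \near (z0 : R[i]^o)^', resolvent_set T z) /\
  exists m : nat, (0 < m)%N /\
  exists A : {linear X -> X}, [/\ bounded_op A, exists x, A x != 0 &
    opnorm (fun x => (z - z0) ^+ m *: resolvent T z x - A x)
      @[z --> (z0 : R[i]^o)^'] --> (0 : R)].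

Definition ergodic_hilbert_sum T z (x : X) (N : nat) : X :=
  \sum_(1 <= n < N.+1) (z ^+ n / n%:R) *: iter n T x.

End Operators.

(* Main.v *)
Require Import Defs.
From HB Require Import structures.
From mathcomp Require Import all_boot all_order all_algebra.
From mathcomp Require Import all_classical all_reals all_analysis.
From mathcomp Require Import complex.
From mathcomp Require Import ring lra zify.

Set Implicit Arguments.
Unset Strict Implicit.
Unset Printing Implicit Defensive.
Import Order.TTheory GRing.Theory Num.Theory.
Import numFieldNormedType.Exports.

Local Open Scope classical_set_scope.
Local Open Scope ring_scope.

(** The proof reduces the theorem to power boundedness of T, and obtains that
    from a resolvent argument without contour integrals.

    For each unimodular z the Cesaro means of z^* T converge in norm to an
    operator E_z with T E_z = E_z T = z E_z.  For large n the n-th mean is a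
    strict contraction on ker E_z, so I - M_n is onto there by a Neumann
    series; since I - M_n factors through I - z^* T, this gives
    ker E_z = (z - T) X ([spectral_limit], [ker_limit_range]).  Hence E_z = 0
    off the spectrum, and E_z E_w = 0 for z != w.

    Let E_j be the limit at l_j and put S = T (I - E_1 - ... - E_k).  Now the
    Cesaro means of z S tend to 0 in norm for every unimodular z, so I - z S is
    bounded below for each such z, with a constant that may be chosen uniform by
    compactness of the circle.  For t < 1 close to 1 this bounds the difference
    of the inverses of I - z S and I - t z S by a small d, uniformly in z, and
    the same d serves all powers S^(2^a), because (I - z^2 S^2)^-1 is the average
    of (I - z S)^-1 and (I + z S)^-1 ([stable_pow2]).  The term t^n S^n, n = 2^a,
    is negligible for large n, as S^n grows at most linearly, and the comparison
    with t = 1 then forces S^n itself to be small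
    ([iter_nonexpansive]).  Adding back the finitely many unimodular
    eigenvalues, T is power bounded ([op_power_bounded]).

    If x = (z^* - T) y with |z| = 1, the sums of z^n T^n x telescope and stay
    bounded, so Abel summation makes the series with weights 1/n converge
    ([hilbert_sum_cvg]); this is (i) and half of (ii).  Conversely, applying
    E_j to the series at z = l_j^* gives the harmonic series times E_j x, so
    convergence forces E_j x = 0, that is, x in (l_j - T) X
    ([hilbert_sum_cvg_ker]).  Finally each l_j - T maps the closed subspace
    on which all E_j vanish onto itself, while E_j kills the range of the
    product, so this subspace is both sides of the identity in (iii)
    ([range_prodE]). *)


(** * Real-valued norms and convergence *)

Section RealNorm.
Variable R : realType.

(** A norm with values in R[i] lies on the real axis; moving it to R puts the
    estimates in a totally ordered field. *)
Definition nrm {V : normedZmodType R[i]} (x : V) : R := complex.Re `|x|.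

Lemma nrmE (V : normedZmodType R[i]) (x : V) : `|x| = ((nrm x)%:C)%C.
Proof. by rewrite /nrm RRe_real// ger0_real. Qed.

Lemma nrm_ge0 (V : normedZmodType R[i]) (x : V) : 0 <= nrm x.
Proof. by rewrite -ler0c -nrmE. Qed.

Lemma nrmD (V : normedZmodType R[i]) (x y : V) : nrm (x + y) <= nrm x + nrm y.
Proof. by rewrite -lecR rmorphD/= -!nrmE ler_normD. Qed.

Lemma nrmN (V : normedZmodType R[i]) (x : V) : nrm (- x) = nrm x.
Proof. by rewrite /nrm normrN. Qed.

Lemma nrmB (V : normedZmodType R[i]) (x y : V) : nrm (x - y) <= nrm x + nrm y.
Proof. by rewrite -(nrmN y) nrmD. Qed.

Lemma nrm_subC (V : normedZmodType R[i]) (x y : V) : nrm (x - y) = nrm (y - x).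
Proof. by rewrite /nrm distrC. Qed.

Lemma nrm0 (V : normedZmodType R[i]) : nrm (0 : V) = 0.
Proof. by rewrite /nrm normr0. Qed.

Lemma nrm_eq0 (V : normedZmodType R[i]) (x : V) : (nrm x == 0) = (x == 0).
Proof. by rewrite -(inj_eq (@complexI R)) -nrmE normr_eq0. Qed.

Lemma nrm_le_eps (V : normedZmodType R[i]) (x : V) :
  (forall e : R, 0 < e -> nrm x <= e) -> x = 0.
Proof.
move=> h; apply/eqP; rewrite -nrm_eq0 eq_le nrm_ge0 andbT.
by apply/ler_addgt0Pl => e /h; rewrite addr0.
Qed.

Lemma nrmZ (V : normedModType R[i]) (a : R[i]) (x : V) :
  nrm (a *: x) = nrm a * nrm x.
Proof. by apply: complexI; rewrite rmorphM/= -!nrmE normrZ. Qed.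

Lemma nrm_sum (V : normedZmodType R[i]) (I : Type) (r : seq I) (P : pred I)
    (f : I -> V) : nrm (\sum_(i <- r | P i) f i) <= \sum_(i <- r | P i) nrm (f i).
Proof.
elim/big_ind2 : _ => //; first by rewrite nrm0.
by move=> x a y b xa yb; apply: le_trans (nrmD _ _) (lerD _ _).
Qed.

Lemma nrm_real (a : R) : nrm (a%:C)%C = `|a|.
Proof. by rewrite /nrm normc_def /= expr0n/= addr0 sqrtr_sqr. Qed.

Lemma nrm_natV (n : nat) : nrm (n%:R^-1 : R[i]) = n%:R^-1.
Proof.
rewrite -[n%:R](rmorph_nat (real_complex R)) -fmorphV nrm_real.
by rewrite ger0_norm ?invr_ge0.
Qed.

Lemma nrm_unit (V : normedZmodType R[i]) (z : V) : `|z| = 1 <-> nrm z = 1.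
Proof. by rewrite nrmE; split=> [/complexI//|->]. Qed.

Lemma nrmX1 (z : R[i]) n : nrm z = 1 -> nrm (z ^+ n) = 1.
Proof. by move=> /nrm_unit h; apply/nrm_unit; rewrite normrX h expr1n. Qed.

Lemma cvgn_nrmP (V : normedModType R[i]) (u : V ^nat) (l : V) :
  u @ \oo --> l <->
  forall e : R, 0 < e -> exists N, forall n, (N <= n)%N -> nrm (l - u n) < e.
Proof.
split=> [/cvgrPdist_lt h e e0|h].
  have [N _ hN] := h (e%:C)%C ltac:(by rewrite ltcR).
  by exists N => n /hN; rewrite nrmE ltcR.
apply/cvgrPdist_lt => e e0.
have er : e = ((complex.Re e)%:C)%C by rewrite RRe_real// gtr0_real.
have [|N hN] := h (complex.Re e); first by rewrite -ltcR -er.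
by exists N => // n /= /hN; rewrite er nrmE ltcR.
Qed.

Lemma cvgn_series_nrmP (V : completeNormedModType R[i]) (u : V ^nat) :
  cvgn (series u) <->
  forall e : R, 0 < e -> exists N, forall m n, (N <= m)%N -> (m <= n)%N ->
    nrm (\sum_(m <= k < n) u k) < e.
Proof.
split=> [/cauchy_cvgP/cauchy_seriesP h e e0|h].
  have [[A B] /= [[N1 _ h1] [N2 _ h2]] hN] := h (e%:C)%C ltac:(by rewrite ltcR).
  exists (maxn N1 N2) => m n Nm mn.
  rewrite -ltcR -nrmE; apply: (hN (m, n)); split=> /=; [apply: h1|apply: h2] => /=; lia.
apply/cauchy_cvgP/cauchy_seriesP => e e0.
have er : e = ((complex.Re e)%:C)%C by rewrite RRe_real// gtr0_real.
have [|N hN] := h (complex.Re e); first by rewrite -ltcR -er.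
exists ([set n | (N <= n)%N], [set n | (N <= n)%N]).
  by split; exists N.
move=> [m n] /= [Nm Nn]; rewrite er nrmE ltcR.
have [mn|/ltnW nm] := leqP m n; first exact: hN.
by rewrite big_geq// nrm0 -ltcR -er.
Qed.


(** Abel summation: with W the partial sums of w, the block from m to n equals
    W_n / (n+1) - W_m / (m+1) plus terms W_k (1/k - 1/(k+1)), whose
    coefficients telescope. *)
Lemma abel_cvg (V : completeNormedModType R[i]) (w : V ^nat) (B : R) :
  (forall n, nrm (\sum_(1 <= k < n.+1) w k) <= B) ->
  cvgn (fun N => \sum_(1 <= k < N.+1) (k%:R^-1 : R[i]) *: w k).
Proof.
move=> hB.
have -> : (fun N => \sum_(1 <= k < N.+1) (k%:R^-1 : R[i]) *: w k)
   = series (fun k => (k.+1%:R^-1 : R[i]) *: w k.+1).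
  by apply/funext => N; rewrite /series/= big_add1.
have B0 : 0 <= B by apply: le_trans (hB 0%N); exact: nrm_ge0.
set W := fun n => \sum_(1 <= k < n.+1) w k.
have key m d : nrm (\sum_(m <= k < m + d) (k.+1%:R^-1 : R[i]) *: w k.+1
      - (m + d).+1%:R^-1 *: W (m + d)%N)
    <= B * (2 * m.+1%:R^-1 - (m + d).+1%:R^-1).
  elim: d => [|d IH].
    rewrite addn0 big_geq// sub0r nrmN nrmZ nrm_natV mulrC.
    rewrite (_ : 2 * _ - _ = m.+1%:R^-1); last by ring.
    by rewrite ler_wpM2r ?invr_ge0 ?hB.
  set n := (m + d)%N in IH *.
  rewrite addnS -/n big_nat_recr/= ?leq_addr//.
  set s := \sum_(_ <= _ < _) _ in IH *.
  have WS : W n.+1 = W n + w n.+1 by rewrite /W big_nat_recr.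
  have -> : s + (n.+1%:R^-1 : R[i]) *: w n.+1 - n.+2%:R^-1 *: W n.+1
     = (s - n.+1%:R^-1 *: W n) + (n.+1%:R^-1 - n.+2%:R^-1) *: W n.+1.
    rewrite [X in _ = _ + X]scalerBl {2}WS scalerDr !addrA; congr (_ - _).
    by rewrite subrK.
  apply: le_trans (nrmD _ _) _.
  have hd : nrm (n.+1%:R^-1 - n.+2%:R^-1 : R[i]) = n.+1%:R^-1 - n.+2%:R^-1.
    rewrite -[n.+1%:R](rmorph_nat (real_complex R)).
    rewrite -[n.+2%:R](rmorph_nat (real_complex R)) -!fmorphV -rmorphB nrm_real.
    by rewrite ger0_norm// subr_ge0 lef_pV2 ?posrE// ler_nat.
  rewrite nrmZ hd.
  have : (n.+1%:R^-1 - n.+2%:R^-1) * nrm (W n.+1) <= (n.+1%:R^-1 - n.+2%:R^-1) * B.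
    by rewrite ler_wpM2l ?hB// subr_ge0 lef_pV2 ?posrE// ler_nat.
  move: IH; move: (m.+1%:R^-1 : R) (n.+1%:R^-1 : R) (n.+2%:R^-1 : R) => a b c.
  move: (nrm _) (nrm _) => p q; nra.
apply/cvgn_series_nrmP => e e0.
have [N hN] : exists N, forall m, (N <= m)%N -> 2 * B * m.+1%:R^-1 < e.
  have := @cvg_harmonic R; move/cvgrPdist_lt.
  have e' : 0 < e / (2 * B + 1) by rewrite divr_gt0// ltr_wpDl// mulr_ge0.
  move=> /(_ _ e')[N _ hN]; exists N => m /hN/=.
  rewrite sub0r normrN ger0_norm ?invr_ge0// ltr_pdivlMr ?ltr_wpDl ?mulr_ge0//.
  have : 0 < m.+1%:R^-1 :> R by rewrite invr_gt0.
  by move: (_^-1) => c; nra.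
exists N => m n Nm mn; apply: le_lt_trans (hN _ Nm).
have := key m (n - m)%N; rewrite subnKC//.
set s := \sum_(_ <= _ < _) _; move=> h.
have -> : s = (s - n.+1%:R^-1 *: W n) + n.+1%:R^-1 *: W n by rewrite subrK.
apply: le_trans (nrmD _ _) _; rewrite nrmZ nrm_natV.
have : n.+1%:R^-1 * nrm (W n) <= n.+1%:R^-1 * B by rewrite ler_wpM2l ?invr_ge0 ?hB.
by move: h; move: (_^-1 : R) (_^-1 : R) (nrm _) (nrm _) => a b p q; nra.
Qed.

End RealNorm.

Section Small.
Variable R : realType.

Lemma nrm_small (V : normedZmodType R[i]) (x : V) (C : R) :
  (forall e : R, 0 < e -> e <= 1 -> nrm x <= e * C) -> x = 0.
Proof.
move=> h; apply: nrm_le_eps => e e0.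
have C0 : 0 <= C.
  by have := h 1 ltr01 (lexx _); rewrite mul1r; apply: le_trans; exact: nrm_ge0.
have d0 : 0 < e / (C + 1 + e) by rewrite divr_gt0// addr_gt0// ltr_wpDl.
have d1 : e / (C + 1 + e) <= 1 by rewrite ler_pdivrMr; lra.
apply: le_trans (h _ d0 d1) _.
by rewrite mulrAC ler_pdivrMr; nra.
Qed.

Lemma natV_small (e : R) : 0 < e ->
  exists N, forall n, (N <= n)%N -> n%:R^-1 <= e.
Proof.
move=> e0; have := @cvg_harmonic R; move/cvgrPdist_lt => /(_ _ e0)[N _ hN].
exists N.+1 => -[//|n] Nn; have /= := hN n Nn.
by rewrite sub0r normrN ger0_norm ?invr_ge0// => /ltW.
Qed.

Lemma half_small (e : R) : 0 < e -> exists N, forall n, (N <= n)%N -> 2^-1 ^+ n <= e.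
Proof.
move=> /natV_small[N hN]; exists N.+1 => n Nn; apply: le_trans (hN n (ltnW Nn)).
rewrite exprVn lef_pV2 ?posrE ?exprn_gt0//; last by rewrite ltr0n; lia.
by rewrite -natrX ler_nat ltnW// ltn_expl.
Qed.

End Small.

(** * Cesaro means and their limit *)

Section Ops.
Variables (R : realType) (X : completeNormedModType R[i]).
Implicit Types (U : {linear X -> X}).

Lemma bounded_opP (S : X -> X) : bounded_op S ->
  exists2 M : R, 0 <= M & forall x, nrm (S x) <= M * nrm x.
Proof.
move=> [M hM]; exists (nrm M); first exact: nrm_ge0.
move=> x; rewrite -lecR rmorphM/= -!nrmE.
have M0 : 0 <= M * `|x| by apply: le_trans (hM x).
by rewrite -[X in _ * X](@ger0_norm R[i])// -normrM ger0_norm.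
Qed.

(** Convergence to 0 in operator norm as an estimate on vectors: by
    homogeneity a nonzero x is rescaled to the unit ball, where the supremum
    bounds the image. *)
Lemma opnorm_cvg0 (D : nat -> {linear X -> X}) :
  (forall n, exists M : R, forall x, nrm (D n x) <= M * nrm x) ->
  opnorm (D n) @[n --> \oo] --> (0 : R) ->
  forall e : R, 0 < e -> exists N, forall n, (N <= n)%N ->
    forall x, nrm (D n x) <= e * nrm x.
Proof.
move=> Db /cvgrPdist_lt D0 e e0; have [N _ hN] := D0 _ e0.
exists N => n /hN /=; rewrite sub0r normrN => De x.
have [->|x0] := eqVneq x 0; first by rewrite linear0 nrm0 mulr0.
have nx : 0 < nrm x by rewrite lt_def nrm_eq0 x0 nrm_ge0.
pose a : R[i] := ((nrm x)^-1%:C)%C.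
have na : nrm a = (nrm x)^-1 by rewrite nrm_real ger0_norm// invr_ge0 ltW.
have : nrm (D n (a *: x)) <= opnorm (D n).
  apply: ub_le_sup; last first.
    exists (a *: x) => //=.
    by rewrite nrmE nrmZ na mulVf// gt_eqF.
  have [M hM] := Db n; exists `|M| => _ [y y1 <-].
  apply: le_trans (hM y) _; apply: le_trans (ler_norm _) _.
  rewrite normrM ler_piMr// ger0_norm ?nrm_ge0//.
  by rewrite -lecR -nrmE.
rewrite linearZ nrmZ na ler_pdivrMl// mulrC => /le_trans -> //.
by rewrite ler_wpM2r ?nrm_ge0// (le_trans (ler_norm _))// ltW.
Qed.

Lemma iter_linear U n : linear (iter n U).
Proof. by elim: n => //= n IH a x y /=; rewrite IH linearP. Qed.

HB.instance Definition _ U n :=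
  GRing.isLinear.Build R[i] X X *:%R (iter n U) (iter_linear U n).

Lemma iter_bound U M : 0 <= M -> (forall x, nrm (U x) <= M * nrm x) ->
  forall n x, nrm (iter n U x) <= M ^+ n * nrm x.
Proof.
move=> M0 hM; elim=> [|n IH] x; first by rewrite expr0 mul1r.
by rewrite iterS exprS -mulrA (le_trans (hM _))// ler_wpM2l.
Qed.

Lemma cesaro_linear U n : linear (cesaro_mean U n).
Proof.
move=> a x y; rewrite /cesaro_mean scalerA mulrC -scalerA -scalerDr.
congr (_ *: _); rewrite scaler_sumr -big_split/=.
by apply: eq_bigr => i _; rewrite linearP.
Qed.

HB.instance Definition _ U n :=
  GRing.isLinear.Build R[i] X X *:%R (cesaro_mean U n) (cesaro_linear U n).

Lemma cesaro_bound U M : 0 <= M -> (forall x, nrm (U x) <= M * nrm x) ->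
  forall n x, nrm (cesaro_mean U n x) <=
    (n%:R^-1 * \sum_(1 <= k < n.+1) M ^+ k) * nrm x.
Proof.
move=> M0 hM n x; rewrite /cesaro_mean nrmZ nrm_natV -mulrA.
rewrite ler_wpM2l ?invr_ge0// mulr_suml; apply: le_trans (nrm_sum _ _ _) _.
by apply: ler_sum => k _; exact: iter_bound.
Qed.

(** The polynomial q in U with (I - U) q = I - M_n. *)
Definition cesaro_quot U n (x : X) : X :=
  (n%:R^-1 : R[i]) *: \sum_(1 <= k < n.+1) \sum_(0 <= i < k) iter i U x.

Lemma telescope_iter U k x :
  \sum_(0 <= i < k) iter i U (x - U x) = x - iter k U x.
Proof.
rewrite (eq_bigr (fun i => - (iter i.+1 U x - iter i U x))).
  by rewrite sumrN telescope_sumr// opprB.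
by move=> i _; rewrite raddfB/= -iterSr opprB.
Qed.

Lemma cesaro_quotE U n x : (0 < n)%N ->
  cesaro_quot U n (x - U x) = x - cesaro_mean U n x.
Proof.
move=> n0; rewrite /cesaro_quot (eq_bigr _ (fun k _ => telescope_iter U k x)).
rewrite sumrB scalerBr sumr_const_nat subSS subn0 -[x *+ n]scaler_nat scalerA.
by rewrite mulVf ?scale1r// pnatr_eq0 -lt0n.
Qed.

Lemma cesaro_quot_comm U n x :
  cesaro_quot U n (x - U x) = cesaro_quot U n x - U (cesaro_quot U n x).
Proof.
rewrite /cesaro_quot linearZ/= -scalerBr; congr (_ *: _).
rewrite raddf_sum -sumrB; apply: eq_bigr => k _.
rewrite raddf_sum -sumrB; apply: eq_bigr => i _.
by rewrite raddfB/= -iterSr -iterS.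
Qed.

Lemma cesaro_quot_bound U M n : 0 <= M -> (forall x, nrm (U x) <= M * nrm x) ->
  exists2 C, 0 <= C & forall x, nrm (cesaro_quot U n x) <= C * nrm x.
Proof.
move=> M0 hM.
exists (n%:R^-1 * \sum_(1 <= k < n.+1) \sum_(0 <= i < k) M ^+ i).
  rewrite mulr_ge0 ?invr_ge0// sumr_ge0// => k _.
  by rewrite sumr_ge0// => i _; rewrite exprn_ge0.
move=> x; rewrite /cesaro_quot nrmZ nrm_natV -mulrA ler_wpM2l ?invr_ge0//.
rewrite mulr_suml (le_trans (nrm_sum _ _ _))//; apply: ler_sum => k _.
rewrite mulr_suml (le_trans (nrm_sum _ _ _))//; apply: ler_sum => i _.
exact: iter_bound.
Qed.

(** Neumann series for an operator that halves the vectors of an invariant set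
    Q: the orbit of y is dominated by a geometric sequence.  The solution w is
    not claimed to lie in Q, so Q need not be closed. *)
Lemma neumann U (Q : X -> Prop) y :
  (exists2 M : R, 0 <= M & forall x, nrm (U x) <= M * nrm x) ->
  (forall x, Q x -> Q (U x)) ->
  (forall x, Q x -> nrm (U x) <= 2^-1 * nrm x) ->
  Q y -> exists w, w - U w = y.
Proof.
move=> [M M0 hM] QU Uh Qy; pose v k := iter k U y.
have Qv k : Q (v k) by elim: k => //= k /QU.
have vb k : nrm (v k) <= 2^-1 ^+ k * nrm y.
  elim: k => [|k IH]; first by rewrite expr0 mul1r.
  by rewrite exprS -mulrA (le_trans (Uh _ (Qv k)))// ler_wpM2l// invr_ge0.
have sb m d : nrm (\sum_(m <= k < m + d) v k)
    <= (2 * 2^-1 ^+ m - 2 * 2^-1 ^+ (m + d)) * nrm y.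
  elim: d => [|d IH]; first by rewrite addn0 big_geq// nrm0 subrr mul0r.
  rewrite addnS big_nat_recr ?leq_addr//= (le_trans (nrmD _ _))//.
  rewrite exprS; move: IH (vb (m + d)%N).
  move: (_ ^+ m) (_ ^+ (m + d)) (nrm _) (nrm _) (nrm y) => a b p q r; lra.
have /cvg_ex[w /cvgn_nrmP hw] : cvgn (series v).
  apply/cvgn_series_nrmP => e e0.
  have e1 : 0 < e / (2 * nrm y + 1) by rewrite divr_gt0// ltr_wpDl// mulr_ge0// nrm_ge0.
  have [N hN] := half_small e1; exists N => m n Nm mn.
  have := sb m (n - m)%N; rewrite subnKC// => /le_lt_trans; apply.
  have := hN m Nm; rewrite ler_pdivlMr ?ltr_wpDl ?mulr_ge0 ?nrm_ge0//.
  have : 0 < 2^-1 ^+ m :> R by rewrite exprn_gt0.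
  have : 0 < 2^-1 ^+ n :> R by rewrite exprn_gt0.
  move: (nrm_ge0 y); move: (_ ^+ m) (_ ^+ n) (nrm y) => a b q; nra.
exists w; apply/subr0_eq; apply: (@nrm_small _ _ _ (1 + M + nrm y)) => e e0 _.
have [N1 h1] := hw _ e0; have [N2 h2] := half_small e0.
pose n := maxn N1 N2.
have hs : series v n - U (series v n) = y - v n.
  rewrite /series/= raddf_sum -sumrB /v -telescope_iter.
  by apply: eq_bigr => i _; rewrite raddfB/= -iterSr -iterS.
have -> : w - U w - y = (w - series v n) - U (w - series v n) - v n.
  rewrite raddfB/= [in RHS]opprB.
  have -> : w - series v n + (U (series v n) - U w) =
      w - U w - (series v n - U (series v n)).
    by rewrite opprB [U _ - U w]addrC addrACA [- _ + U _]addrC.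
  by rewrite hs -[RHS]addrA -opprD subrK.
have a1 := nrmB (w - series v n - U (w - series v n)) (v n).
have a2 := nrmB (w - series v n) (U (w - series v n)).
have a3 := hM (w - series v n).
have a4 := h1 n (leq_maxl _ _).
have a5 := vb n; have a6 := h2 n (leq_maxr _ _).
have a7 : 2^-1 ^+ n * nrm y <= e * nrm y by rewrite ler_wpM2r ?nrm_ge0.
have a8 : M * nrm (w - series v n) <= M * e by rewrite ler_wpM2l// ltW.
lra.
Qed.

Definition ergodic_limit U (E : {linear X -> X}) :=
  forall e : R, 0 < e -> exists N, forall n, (N <= n)%N ->
    forall x, nrm (cesaro_mean U n x - E x) <= e * nrm x.

Lemma uniformly_ergodicP U : uniformly_ergodic U ->
  exists2 E : {linear X -> X},
    (exists2 M : R, 0 <= M & forall x, nrm (E x) <= M * nrm x)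
    & ergodic_limit U E.
Proof.
move=> [/bounded_opP[B B0 hB] [E /bounded_opP[M M0 hM] EC]].
exists E; first by exists M.
apply: (@opnorm_cvg0 (fun n => (cesaro_mean U n \- E : {linear X -> X}))) => // n.
exists (n%:R^-1 * \sum_(1 <= k < n.+1) B ^+ k + M) => x.
by rewrite mulrDl /= (le_trans (nrmB _ _))// lerD// cesaro_bound.
Qed.

Lemma cesaro_rec U n x :
  iter n.+1 U x = n.+1%:R *: cesaro_mean U n.+1 x - n%:R *: cesaro_mean U n x.
Proof.
have h m : m%:R *: cesaro_mean U m x = \sum_(1 <= k < m.+1) iter k U x.
  case: m => [|m]; first by rewrite scale0r big_geq.
  by rewrite /cesaro_mean scalerA mulfV ?scale1r// pnatr_eq0.
by apply/eqP; rewrite !h eq_sym subr_eq addrC -big_nat_recr.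
Qed.

Lemma cesaro_comm U n x : cesaro_mean U n (U x) = U (cesaro_mean U n x).
Proof.
rewrite /cesaro_mean linearZ/=; congr (_ *: _); rewrite raddf_sum.
by apply: eq_bigr => k _; rewrite -iterSr -iterS.
Qed.

Lemma cesaro_fix U n x : (0 < n)%N -> U x = x -> cesaro_mean U n x = x.
Proof.
move=> n0 Ux; have /esym := cesaro_quotE U x n0.
by rewrite Ux subrr /cesaro_quot big1 ?scaler0 => [/subr0_eq//|k _];
  rewrite big1// => i _; rewrite linear0.
Qed.

Section Limit.
Variables (U E : {linear X -> X}).
Hypothesis (UE : ergodic_limit U E).

Lemma limit_fix x : U x = x -> E x = x.
Proof.
move=> Ux; apply/subr0_eq/(@nrm_small _ _ _ (nrm x)) => e e0 _.
have [N hN] := UE e0; have := hN N.+1 (leqnSn _) x.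
by rewrite cesaro_fix// nrm_subC.
Qed.

(** n M_n(U x) = (n+1) M_(n+1) x - U x, so both sides have the same limit. *)
Lemma limit_op x : E (U x) = E x.
Proof.
apply/subr0_eq/(@nrm_small _ _ _ (2 * nrm x + 2 * nrm (U x) + nrm (E x))) => e e0 e1.
have [N hN] := UE e0; have [N' hN'] := natV_small e0.
pose n := maxn N.+1 N'.
have n0 : (0 < n)%N by rewrite /n; lia.
have h : cesaro_mean U n (U x) - cesaro_mean U n.+1 x =
    n%:R^-1 *: (cesaro_mean U n.+1 x - U x).
  have /esym Se : \sum_(1 <= k < n.+2) iter k U x = n.+1%:R *: cesaro_mean U n.+1 x.
    by rewrite /cesaro_mean scalerA mulfV ?scale1r// pnatr_eq0.
  rewrite {1}/cesaro_mean.
  have -> : \sum_(1 <= k < n.+1) iter k U (U x) = n.+1%:R *: cesaro_mean U n.+1 x - U x.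
    apply/eqP; rewrite Se eq_sym subr_eq big_nat_recl// addrC.
    by apply/eqP; congr (_ + _); apply: eq_bigr => k _; rewrite iterSr.
  have nn : (n%:R : R[i]) != 0 by rewrite pnatr_eq0 -lt0n.
  rewrite -[n.+1]addn1 natrD scalerDl scale1r -addrA scalerDr scalerA mulVf// scale1r.
  by rewrite addrAC subrr add0r.
have -> : E (U x) - E x = - (cesaro_mean U n (U x) - E (U x))
    + n%:R^-1 *: (cesaro_mean U n.+1 x - U x) + (cesaro_mean U n.+1 x - E x).
  by rewrite -h opprB !addrA !subrK.
have N1 : (N <= n)%N by rewrite /n; lia.
have a1 := hN n N1 (U x).
have a2 := hN n.+1 (leqW N1) x.
have a3 := hN' n (leq_maxr _ _).
apply: le_trans (nrmD _ _) _.
apply: le_trans (lerD (nrmD _ _) (lexx _)) _.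
rewrite nrmN nrmZ nrm_natV.
have a4 := nrmB (cesaro_mean U n.+1 x) (U x).
have a5 := nrmD (cesaro_mean U n.+1 x - E x) (E x); rewrite subrK in a5.
have a6 : n%:R^-1 * nrm (cesaro_mean U n.+1 x - U x) <=
    e * (nrm x + nrm (E x) + nrm (U x)).
  apply: ler_pM; rewrite ?invr_ge0 ?nrm_ge0//.
  have : e * nrm x <= nrm x by rewrite ler_piMl ?nrm_ge0.
  lra.
lra.
Qed.

Lemma limit_cesaro n x : (0 < n)%N -> E (cesaro_mean U n x) = E x.
Proof.
move=> n0; apply/esym/subr0_eq; rewrite -raddfB -cesaro_quotE//.
by rewrite cesaro_quot_comm raddfB/= limit_op subrr.
Qed.

Variable B : R.
Hypotheses (B0 : 0 <= B) (hB : forall x, nrm (U x) <= B * nrm x).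

Lemma op_limit x : U (E x) = E x.
Proof.
rewrite -[RHS]limit_op.
apply/subr0_eq/(@nrm_small _ _ _ (B * nrm x + nrm (U x))) => e e0 e1.
have [N hN] := UE e0.
have a1 := hN N (leqnn _) x; have a2 := hN N (leqnn _) (U x).
rewrite cesaro_comm in a2.
have -> : U (E x) - E (U x) =
    - U (cesaro_mean U N x - E x) + (U (cesaro_mean U N x) - E (U x)).
  by rewrite raddfB/= opprB addrA subrK.
apply: le_trans (nrmD _ _) _; rewrite nrmN mulrDr lerD//.
apply: le_trans (hB _) _; rewrite mulrCA ler_wpM2l//.
Qed.



(** On ker E some mean M_N has norm at most 1/2, so I - M_N is onto by a
    Neumann series, and I - M_N = (I - U) q. *)
Lemma ker_limit_range x : E x = 0 -> exists y, y - U y = x.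
Proof.
move=> Ex; have [|N hN] := UE (e := 2^-1); first by rewrite invr_gt0.
have [w hw] : exists w, w - cesaro_mean U N.+1 w = x.
  apply: (@neumann _ (fun x => E x = 0)) => //.
  - exists (N.+1%:R^-1 * \sum_(1 <= k < N.+2) B ^+ k); last exact: cesaro_bound.
    by rewrite mulr_ge0 ?invr_ge0// sumr_ge0// => k _; rewrite exprn_ge0.
  - by move=> y Ey; rewrite /= limit_cesaro.
  - by move=> y Ey; have := hN N.+1 (leqnSn _) y; rewrite Ey subr0.
by exists (cesaro_quot U N.+1 w); rewrite -cesaro_quot_comm cesaro_quotE.
Qed.

End Limit.

End Ops.

(** * Bounds uniform on the unit circle *)

Section Circle.
Variable R : realType.

Lemma nrmM (z w : R[i]) : nrm (z * w) = nrm z * nrm w.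
Proof. by apply: complexI; rewrite rmorphM/= -!nrmE normrM. Qed.

Lemma nrm_ge_Re (z : R[i]) : `|complex.Re z| <= nrm z.
Proof. by rewrite -lecR -nrmE normc_ge_Re. Qed.

Lemma nrm_i : nrm ('i%C : R[i]) = 1.
Proof. by rewrite /nrm normc_def/= expr0n expr1n add0r sqrtr1. Qed.

Lemma nrm_ge_Im (z : R[i]) : `|complex.Im z| <= nrm z.
Proof.
have := nrm_ge_Re (z * 'i%C).
by rewrite ReiNIm normrN nrmM nrm_i mulr1.
Qed.

Lemma nrm_le_ReIm (z : R[i]) : nrm z <= `|complex.Re z| + `|complex.Im z|.
Proof.
by rewrite [in leLHS](complexE z) (le_trans (nrmD _ _))// nrmM nrm_i mul1r !nrm_real.
Qed.

Lemma nrm_ler_sub (V : normedZmodType R[i]) (x y : V) :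
  `|nrm x - nrm y| <= nrm (x - y).
Proof.
have := nrmD (x - y) y; have := nrmD (y - x) x; rewrite !subrK (nrm_subC y x) => h1 h2.
by rewrite ler_norml; apply/andP; split; lra.
Qed.

(** Compactness of the circle, for a monotone family of properties that hold
    locally.  The covering argument runs on the square [-1, 1]^2 of real and
    imaginary parts; points off the circle have a neighbourhood off it. *)
Lemma circle_uniform (P : nat -> R[i] -> Prop) :
  (forall m n z, (m <= n)%N -> P m z -> P n z) ->
  (forall z, nrm z = 1 -> exists n, exists2 r : R, 0 < r &
     forall z', nrm (z - z') < r -> P n z') ->
  exists n, forall z, nrm z = 1 -> P n z.
Proof.
move=> Pmono Ploc.
have K : compact (`[-1, 1]%classic `*` `[-1, 1]%classic : set (R * R)).
  by apply: compact_setX; exact: segment_compact.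
have dist (a b a' b' : R) r : 0 < r -> ball a (r / 2) a' -> ball b (r / 2) b' ->
    nrm ((a +i* b)%C - (a' +i* b')%C) < r.
  rewrite -!ball_normE/= => r0 h1 h2; apply: le_lt_trans (nrm_le_ReIm _) _.
  by rewrite /=; lra.
have [|N _ hN] := (iffLR (compact_near_coveringP _) K) nat \oo
    (fun n p => nrm (p.1 +i* p.2)%C = 1 -> P n (p.1 +i* p.2)%C) _.
  move=> [a b] _.
  have [z1|z1] := eqVneq (nrm (a +i* b)%C) 1.
    have [n [r r0 hr]] := Ploc _ z1.
    have r2 : 0 < r / 2 by lra.
    exists (ball (a, b) (r / 2), [set m | (n <= m)%N]).
      by split; [exact: nbhsx_ballx|exists n].
    move=> [[a' b'] m] /= [[h1 h2] nm] _; apply: (Pmono n) => //.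
    by apply: hr; apply: dist.
  pose r := `|nrm (a +i* b)%C - 1|.
  have r0 : 0 < r by rewrite normr_gt0 subr_eq0.
  have r2 : 0 < r / 2 by lra.
  exists (ball (a, b) (r / 2), setT); first by split; [exact: nbhsx_ballx|exact: filterT].
  move=> [[a' b'] m] /= [[h1 h2] _] z'1.
  have := dist _ _ _ _ _ r0 h1 h2.
  by rewrite ltNge (le_trans _ (nrm_ler_sub _ _))// z'1.
exists N => z z1; have := hN N (leqnn N) (complex.Re z, complex.Im z).
have e : (complex.Re z +i* complex.Im z)%C = z by case: (z).
rewrite /= e; apply => //.
have := nrm_ge_Re z; have := nrm_ge_Im z; rewrite z1 !ler_norml => h1 h2.
by split; rewrite /= in_itv/=.
Qed.

End Circle.

(** * Operators that are bounded below along the circle *)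

Section Decay.
Variables (R : realType) (X : completeNormedModType R[i]).
Implicit Types (S : {linear X -> X}).

Lemma uniform_lower_bound S (B : R) : 0 <= B -> (forall x, nrm (S x) <= B * nrm x) ->
  (forall z : R[i], nrm z = 1 -> exists2 c : R, 0 <= c &
     forall x, nrm x <= c * nrm (x - z *: S x)) ->
  exists2 c : R, 0 <= c & forall z : R[i], nrm z = 1 ->
     forall x, nrm x <= c * nrm (x - z *: S x).
Proof.
move=> B0 hB hloc.
have [||n hn] := @circle_uniform R
    (fun n z => forall x, nrm x <= n%:R * nrm (x - z *: S x)).
- move=> m n z mn h x; apply: le_trans (h x) _.
  by rewrite ler_wpM2r ?nrm_ge0// ler_nat.
- move=> z /hloc[c c0 hc].
  exists (Num.truncn (2 * c)).+1.
  have D0 : 0 < 2 * c * B + 1 by rewrite ltr_wpDl// !mulr_ge0.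
  exists (2 * c * B + 1)^-1; first by rewrite invr_gt0.
  move=> z' zz' x; apply: (@le_trans _ _ (2 * c * nrm (x - z' *: S x))); last first.
    by rewrite ler_wpM2r ?nrm_ge0// ltW// truncnS_gt.
  have a1 := hc x.
  have -> : x - z' *: S x = (x - z *: S x) + (z - z') *: S x.
    by rewrite scalerBl addrA subrK.
  have a2 : nrm (x - z *: S x) <=
      nrm ((x - z *: S x) + (z - z') *: S x) + nrm (z - z') * (B * nrm x).
    rewrite -[X in nrm X <= _](addrK ((z - z') *: S x)) (le_trans (nrmB _ _))// lerD2l.
    by rewrite nrmZ ler_wpM2l ?nrm_ge0.
  have a3 : nrm (z - z') * (2 * c * B) <= 1.
    apply: (@le_trans _ _ ((2 * c * B + 1)^-1 * (2 * c * B + 1))); last first.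
      by rewrite mulVf// gt_eqF.
    by apply: ler_pM; [exact: nrm_ge0|rewrite !mulr_ge0|exact: ltW|rewrite lerDl].
  have b1 := ler_wpM2l c0 a2.
  have b2 := ler_wpM2r (nrm_ge0 x) a3.
  lra.
by exists n%:R => // z z1; exact: hn.
Qed.

Lemma half_sum (V : zmodType) (x y a b : V) :
  (x + a - (y + b)) + (x - a - (y - b)) = (x - y) *+ 2.
Proof.
rewrite !opprD opprK (addrACA x a) (addrACA x (- a)) (addrACA (x - y)) mulr2n.
by rewrite [- a + b]addrC -[b - a]opprB subrr addr0.
Qed.

(** Where I - z S and I - s z S are invertible this says that their inverses
    differ by at most d in norm.  Comparing two solutions of the same equation
    avoids any assumption of invertibility. *)
Definition stable (S : X -> X) (s : R[i]) (d : R) := forall z : R[i], nrm z = 1 ->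
  forall x x', x - z *: S x = x' - (s * z) *: S x' ->
  nrm (x - x') <= d * nrm (x - z *: S x).

(** If (I - z^2 S^2) x = y, then (I + z S) x and (I - z S) x solve the
    equations for z and -z with the same y, and x is their average; the
    same holds for x' with s z. *)
Lemma stable_sqr S s d : stable S s d -> stable (S \o S) (s ^+ 2) d.
Proof.
move=> st w w1 x x' e.
have [z zw] : exists z : R[i], z ^+ 2 = w by exists (sqrtC w); rewrite sqrtCK.
have z1 : nrm z = 1.
  have : nrm z ^+ 2 = 1 by rewrite expr2 -nrmM -expr2 zw.
  move=> /eqP; rewrite sqrf_eq1 => /orP[/eqP//|/eqP h].
  by have := nrm_ge0 z; rewrite h; lra.
have fac (a : R[i]) v : (v + a *: S v) - a *: S (v + a *: S v) = v - a ^+ 2 *: S (S v).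
  have -> : S (v + a *: S v) = S v + a *: S (S v) by rewrite linearD linearZ.
  by rewrite scalerDr scalerA -expr2 opprD addrA addrK.
have half (f : R[i]) : nrm f = 1 -> f ^+ 2 = w ->
   nrm ((x + f *: S x) - (x' + (s * f) *: S x')) <= d * nrm (x - w *: S (S x)).
  move=> f1 fw; have := st f f1 (x + f *: S x) (x' + (s * f) *: S x').
  by rewrite !fac exprMn fw; apply.
have h1 := half z z1 zw.
have h2 := half (- z); rewrite nrmN sqrrN in h2; have {}h2 := h2 z1 zw.
rewrite /= in h1 h2 *.
have : nrm (2%:R *: (x - x')) <= 2 * (d * nrm (x - w *: S (S x))).
  have -> : 2%:R *: (x - x') = ((x + z *: S x) - (x' + (s * z) *: S x'))
     + ((x + (- z) *: S x) - (x' + (s * (- z)) *: S x')).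
    by rewrite mulrN !scaleNr scaler_nat half_sum.
  by apply: le_trans (nrmD _ _) _; lra.
rewrite nrmZ (_ : nrm (2%:R : R[i]) = 2); last first.
  by rewrite -[2%:R](rmorph_nat (real_complex R)) nrm_real ger0_norm.
lra.
Qed.

Lemma stable_pow2 a : forall S s d, stable S s d ->
  stable (iter (2 ^ a) S) (s ^+ (2 ^ a)) d.
Proof.
elim: a => [|a IH] S s d st; first by rewrite expn0 expr1; exact: st.
have := IH _ _ _ (stable_sqr st).
rewrite expnS exprM mulnC (_ : iter _ (S \o S) = iter (2 ^ a * 2) S)//.
by apply/funext => x; rewrite iterM.
Qed.

(** First-order perturbation: (I - z S)(x - x') = h z S x', and x' itself is
    controlled by y through the lower bound once c B h <= 1/2. *)
Lemma stable_of_lower_bound S (B c h : R) :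
  0 <= B -> (forall x, nrm (S x) <= B * nrm x) -> 0 <= c ->
  (forall z : R[i], nrm z = 1 -> forall x, nrm x <= c * nrm (x - z *: S x)) ->
  0 <= h -> c * B * h <= 2^-1 ->
  stable S ((1 - h)%:C)%C (c * B * h * (2 * c)).
Proof.
move=> B0 hB c0 hc h0 small z z1 x x' e.
set y := x - z *: S x in e *.
have hz : nrm ((h%:C)%C * z) = h by rewrite nrmM z1 mulr1 nrm_real ger0_norm.
have e1 : x' - z *: S x' = y - ((h%:C)%C * z) *: S x'.
  by rewrite e rmorphB/= rmorph1 mulrBl mul1r scalerBl opprB addrA [RHS]addrAC addrK.
have a1 : nrm (x' - z *: S x') <= nrm y + h * (B * nrm x').
  by rewrite e1 (le_trans (nrmB _ _))// lerD2l nrmZ hz ler_wpM2l.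
have a2 : nrm x' <= 2 * c * nrm y.
  have b1 := ler_wpM2l c0 a1.
  have b2 := ler_wpM2r (nrm_ge0 x') small.
  have := hc z z1 x'; lra.
have e2 : (x - x') - z *: S (x - x') = ((h%:C)%C * z) *: S x'.
  have -> : S (x - x') = S x - S x' by rewrite linearB.
  have -> : x - x' - z *: (S x - S x') = y - (x' - z *: S x').
    by rewrite scalerBr /y !opprD !opprK addrACA.
  by rewrite e1 subKr.
have := hc z z1 (x - x'); rewrite e2 nrmZ hz => /le_trans; apply.
have : c * (h * nrm (S x')) <= c * (h * (B * (2 * c * nrm y))).
  by rewrite !ler_wpM2l// (le_trans (hB _))// ler_wpM2l.
lra.
Qed.

Lemma bernoulli (k : R) n : 0 <= k -> 1 + n%:R * k <= (1 + k) ^+ n.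
Proof.
move=> k0; elim: n => [|n IH]; first by rewrite mul0r addr0 expr0.
have : (1 + k) * (1 + n%:R * k) <= (1 + k) ^+ n.+1.
  by rewrite exprS ler_wpM2l// addr_ge0.
apply: le_trans; rewrite -natr1; have : 0 <= n%:R * k * k by rewrite !mulr_ge0.
nra.
Qed.

(** Take t < 1 close to 1 and n = 2^a so large that t^n S^n has norm at most
    1/8, which linear growth of S^n permits.  For y = x - S^n x, the Neumann
    series gives x' with x' - t^n S^n x' = y.  Then x' is close to y by the
    choice of n, and to x by stability, hence S^n x = x - y is small. *)
Lemma iter_nonexpansive S (B : R) : 0 <= B -> (forall x, nrm (S x) <= B * nrm x) ->
  (exists N, forall n, (N <= n)%N -> forall x, nrm (iter n S x) <= 2 * n%:R * nrm x) ->
  (forall z : R[i], nrm z = 1 -> exists2 c : R, 0 <= c &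
     forall x, nrm x <= c * nrm (x - z *: S x)) ->
  exists2 n, (0 < n)%N & forall x, nrm (iter n S x) <= nrm x.
Proof.
move=> B0 hB [N hN] /(uniform_lower_bound B0 hB)[c c0 hc].
(* t = (1 + k)^-2 makes t^n O(1/(n k)^2) by Bernoulli, which beats the linear
   growth; k is small enough for the perturbation bound to be 1/8. *)
pose k : R := (32 * (1 + B) * (1 + c) ^+ 2)^-1.
have D0 : 1 <= 32 * (1 + B) * (1 + c) ^+ 2.
  have : 1 <= (1 + c) ^+ 2 by rewrite expr_ge1 ?ler_wpDr ?addr_ge0.
  nra.
have k0 : 0 < k by rewrite invr_gt0 (lt_le_trans _ D0).
pose t : R := (1 + k) ^- 2.
have t0 : 0 < t by rewrite invr_gt0 exprn_gt0// addr_gt0.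
have t2 : t * (1 + k) ^+ 2 = 1 by rewrite mulVf// gt_eqF// exprn_gt0// addr_gt0.
have t1 : t <= 1 by nra.
have th : 1 - t <= 2 * k.
  have k1 : k <= 1 by rewrite invf_le1// (lt_le_trans _ D0).
  nra.
have kE : k * (32 * (1 + B) * (1 + c) ^+ 2) = 1.
  by rewrite mulVf// gt_eqF// (lt_le_trans _ D0).
have small1 : c * B * (1 - t) <= 16^-1.
  have : c * B * (1 - t) <= c * B * (2 * k) by rewrite ler_wpM2l ?mulr_ge0.
  have : k * (32 * (c * B)) <= k * (32 * (1 + B) * (1 + c) ^+ 2).
    rewrite ler_wpM2l ?ltW//; nra.
  rewrite kE; nra.
have small2 : c * B * (1 - t) * (2 * c) <= 8^-1.
  have : c * B * (1 - t) * (2 * c) <= c * B * (2 * k) * (2 * c).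
    by rewrite ler_wpM2r ?mulr_ge0// ler_wpM2l ?mulr_ge0.
  have : k * (32 * (c * B * c)) <= k * (32 * (1 + B) * (1 + c) ^+ 2).
    rewrite ler_wpM2l ?ltW//.
    have := mulr_ge0 c0 B0; have := mulr_ge0 c0 (mulr_ge0 c0 B0).
    by have := mulr_ge0 c0 c0; lra.
  rewrite kE; nra.
have st : stable S (t%:C)%C 8^-1.
  have := stable_of_lower_bound B0 hB c0 hc (h := 1 - t).
  rewrite subKr subr_ge0 => /(_ t1 ltac:(lra)) st z z1 x x' /(st z z1)/le_trans; apply.
  by rewrite ler_wpM2r ?nrm_ge0.
have [N' hN'] := natV_small (e := k ^+ 2 / 16) ltac:(by rewrite divr_gt0// exprn_gt0).
pose a := (N + N')%N; pose n := (2 ^ a)%N.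
have an : (a < n)%N by exact: ltn_expl.
have n0 : (0 < n)%N by lia.
exists n => // x.
pose U := ((t%:C)%C ^+ n) \*: iter n S.
have tn : nrm ((t%:C)%C ^+ n) = t ^+ n.
  by rewrite -rmorphXn/= nrm_real ger0_norm// exprn_ge0// ltW.
have Ub v : nrm (U v) <= 8^-1 * nrm v.
  rewrite /U/= nrmZ tn.
  have : t ^+ n * nrm (iter n S v) <= t ^+ n * (2 * n%:R * nrm v).
    by apply: ler_wpM2l; [rewrite exprn_ge0// ltW | apply: hN; lia].
  move=> /le_trans; apply; rewrite mulrA ler_wpM2r ?nrm_ge0//.
  have b : n%:R * k <= (1 + k) ^+ n.
    by apply: le_trans (bernoulli n (ltW k0)); rewrite ler_wpDl.
  have b2 : (n%:R * k) ^+ 2 <= (1 + k) ^+ 2 ^+ n.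
    have k0' := ltW k0.
    by rewrite exprAC ler_pXn2r// nnegrE ?exprn_ge0 ?mulr_ge0 ?addr_ge0.
  have tn0 : 0 < t ^+ n by rewrite exprn_gt0.
  have b3 : t ^+ n * (n%:R * k) ^+ 2 <= 1.
    apply: (@le_trans _ _ (t ^+ n * (1 + k) ^+ 2 ^+ n)); first by rewrite ler_wpM2l// ltW.
    by rewrite -exprMn t2 expr1n.
  have := hN' n ltac:(lia); move: b3.
  have : 0 < n%:R :> R by rewrite ltr0n.
  move: (t ^+ n) tn0 (n%:R) => p p0 q q0 b3 hq.
  have : q^-1 * (16 * q) <= k ^+ 2 / 16 * (16 * q) by rewrite ler_wpM2r// mulr_ge0// ltW.
  rewrite mulrCA mulVf ?gt_eqF// => b4.
  have b5 : p * q * 16 <= p * q * (q * k ^+ 2).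
    by apply: ler_wpM2l; [rewrite mulr_ge0// ltW | lra].
  nra.
have [x' hx'] : exists x', x' - U x' = x - iter n S x.
  apply: (@neumann _ _ _ (fun=> True)) => // [|v _].
    by exists 8^-1.
  by apply: le_trans (Ub v) _; rewrite ler_wpM2r ?nrm_ge0//; lra.
have := @stable_pow2 a _ _ _ st; rewrite -/n => /(_ 1).
rewrite -(rmorph1 (real_complex R)) nrm_real normr1 => /(_ erefl x x').
rewrite rmorph1 mulr1 scale1r => /(_ (esym hx')).
have a1 := nrmD (x' - U x') (U x'); rewrite subrK hx' in a1.
have a2 := nrmB x (iter n S x); have a3 := Ub x'.
move=> a4.
have a5 : nrm (iter n S x) <= nrm (x - x') + nrm (U x').
  have -> : iter n S x = (x - x') + U x'.
    by rewrite -[U x'](subKr x') hx' addrA subrK subKr.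
  exact: nrmD.
have := nrm_ge0 x; lra.
Qed.

End Decay.

(** * Splitting off the peripheral eigenspaces *)

Section Rotation.
Variables (R : realType) (X : completeNormedModType R[i]).
Implicit Types (T U : {linear X -> X}).

Lemma conj_unit (z : R[i]) : `|z| = 1 -> z^* * z = 1.
Proof. by move=> z1; rewrite mulrC -normCK z1 expr1n. Qed.

Lemma iter_scale (a : R[i]) T n x : iter n (a \*: T) x = a ^+ n *: iter n T x.
Proof.
elim: n => [|n IH] /=; first by rewrite expr0 scale1r.
by rewrite IH linearZ scalerA -exprS.
Qed.

Lemma nrmZ_nat n (x : X) : nrm (n%:R *: x) = n%:R * nrm x.
Proof.
by rewrite nrmZ -[n%:R](rmorph_nat (real_complex R)) nrm_real ger0_norm.
Qed.

Definition power_bounded T :=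
  exists2 K : R, 0 <= K & forall n x, nrm (iter n T x) <= K * nrm x.

(** With U = z T and y' = z^* y the vector is y' - U y', so the partial sums of
    U^n telescope. *)
Lemma hilbert_sum_cvg T (z : R[i]) (y : X) : power_bounded T -> `|z| = 1 ->
  cvgn (ergodic_hilbert_sum T z (scalar_sub (z^*) T y)).
Proof.
move=> [K K0 hK] z1; set x := scalar_sub _ _ _.
pose U := z \*: T; pose y' := z^* *: y.
have xE : x = y' - U y'.
  have Ty : T y' = z^* *: T y by rewrite linearZ.
  by rewrite /x /scalar_sub /U /= Ty scalerA mulrC conj_unit// scale1r.
have -> : ergodic_hilbert_sum T z x =
    (fun N => \sum_(1 <= k < N.+1) (k%:R^-1 : R[i]) *: iter k U x).
  apply/funext => N; apply: eq_bigr => k _.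
  by rewrite iter_scale scalerA [in RHS]mulrC.
apply: (@abel_cvg _ _ _ (K * nrm y' + K * nrm y')) => n.
have -> : \sum_(1 <= k < n.+1) iter k U x = iter 1 U y' - iter n.+1 U y'.
  rewrite xE -[RHS]opprB -(@telescope_sumr _ 1 n.+1 (fun k => iter k U y'))// -sumrN.
  by apply: eq_bigr => i _; rewrite raddfB/= -iterSr iterS opprB.
have Ub m : nrm (iter m U y') <= K * nrm y'.
  by rewrite iter_scale nrmZ nrmX1 ?mul1r//; apply/nrm_unit.
by rewrite (le_trans (nrmB _ _))// lerD.
Qed.

(** E is the limit of the Cesaro means of z^* T, that is, the projection onto
    the eigenspace of z along the range of z - T. *)
Record spectral_limit T (z : R[i]) (E : {linear X -> X}) : Prop := SpectralLimit {
  sl_bound : exists2 M : R, 0 <= M & forall x, nrm (E x) <= M * nrm x;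
  sl_opE : forall x, T (E x) = z *: E x;
  sl_Eop : forall x, E (T x) = z *: E x;
  sl_fix : forall x, T x = z *: x -> E x = x;
  sl_ker : forall x, E x = 0 -> exists y, scalar_sub z T y = x;
  sl_erg : ergodic_limit (z^* \*: T) E }.

Lemma spectral_limitP T (z : R[i]) : rotationally_uniformly_ergodic T -> `|z| = 1 ->
  exists E, spectral_limit T z E.
Proof.
move=> T_rue z1.
have c1 : `|z^*| = 1 by rewrite norm_conjC.
have ue := T_rue _ c1.
have [E [M M0 hM] erg] := uniformly_ergodicP ue.
case: ue => /bounded_opP[B B0 hB] _.
have zc : z * z^* = 1 by rewrite mulrC conj_unit.
exists E; split => //; first by exists M.
- move=> x; have := op_limit erg B0 hB x => /= h.
  by rewrite -[in RHS]h scalerA zc scale1r.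
- move=> x; have h := limit_op erg x; rewrite /= linearZ in h.
  by rewrite -[in RHS]h scalerA zc scale1r.
- move=> x Tx; apply: (limit_fix erg); rewrite /= Tx scalerA.
  by rewrite conj_unit// scale1r.
- move=> x /(ker_limit_range erg B0 hB)[y <-]; exists (z^* *: y).
  by rewrite /scalar_sub [T _]linearZ /= scalerA zc scale1r.
Qed.

Lemma sl_range T z E y : spectral_limit T z E -> E (scalar_sub z T y) = 0.
Proof. by move=> sE; rewrite /scalar_sub linearB linearZ/= (sl_Eop sE) subrr. Qed.

Section Decomposition.
Variables (T : {linear X -> X}) (k : nat) (l : 'I_k -> R[i]).
Variable (E : 'I_k -> {linear X -> X}).
Hypotheses (l_inj : injective l) (l_unit : forall j, `|l j| = 1).
Hypothesis sE : forall j, spectral_limit T (l j) (E j).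
Hypothesis Tb : bounded_op T.
Hypothesis T_rue : rotationally_uniformly_ergodic T.
Hypothesis off : forall z, `|z| = 1 -> (forall j, z != l j) ->
  forall w, T w = z *: w -> w = 0.

Lemma sl_orth i j x : i != j -> E i (E j x) = 0.
Proof.
move=> ij; apply/eqP; have : (l j - l i) *: E i (E j x) = 0.
  by rewrite scalerBl -(sl_Eop (sE i)) (sl_opE (sE j)) linearZ subrr.
by move=> /eqP; rewrite scaler_eq0 subr_eq0 (inj_eq l_inj) eq_sym (negPf ij).
Qed.

Lemma sl_idem j x : E j (E j x) = E j x.
Proof. by rewrite (sl_fix (sE j))// (sl_opE (sE j)). Qed.

Definition compl_proj x := x - \sum_j E j x.

Lemma compl_proj_linear : linear compl_proj.
Proof.
move=> a x y; rewrite /compl_proj.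
under eq_bigr do rewrite linearP.
rewrite big_split/= -scaler_sumr scalerBr opprD addrACA //.
Qed.

HB.instance Definition _ :=
  GRing.isLinear.Build R[i] X X *:%R compl_proj compl_proj_linear.

Lemma compl_proj_ker j x : E j (compl_proj x) = 0.
Proof.
rewrite /compl_proj linearB linear_sum (bigD1 j)//= big1 => [|i ij].
  by rewrite addr0 sl_idem subrr.
by rewrite sl_orth// eq_sym.
Qed.

Lemma compl_proj_id x : (forall j, E j x = 0) -> compl_proj x = x.
Proof. by move=> h; rewrite /compl_proj big1 ?subr0. Qed.

Lemma compl_proj_op x : compl_proj (T x) = T (compl_proj x).
Proof.
rewrite /compl_proj [T (_ - _)]linearB; congr (_ - _).
rewrite [T (\sum_j _)]linear_sum; apply: eq_bigr => j _.
by rewrite (sl_Eop (sE j)) (sl_opE (sE j)).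
Qed.

Lemma compl_proj_iter n x : compl_proj (iter n T x) = iter n T (compl_proj x).
Proof. by elim: n => //= n IH; rewrite compl_proj_op IH. Qed.

Lemma sum_bound : exists2 M : R, 0 <= M & forall x, \sum_j nrm (E j x) <= M * nrm x.
Proof.
have [M hM] : exists M : 'I_k -> R,
    forall j, 0 <= M j /\ forall x, nrm (E j x) <= M j * nrm x.
  suff /boolp.choice[M hM] : forall j, exists M : R,
    0 <= M /\ forall x, nrm (E j x) <= M * nrm x by exists M.
  by move=> j; have [M M0 hM] := sl_bound (sE j); exists M.
exists (\sum_j M j); first by apply: sumr_ge0 => j _; case: (hM j).
by move=> x; rewrite mulr_suml; apply: ler_sum => j _; case: (hM j).
Qed.

Lemma compl_proj_bound :
  exists2 M : R, 0 <= M & forall x, nrm (compl_proj x) <= M * nrm x.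
Proof.
have [M M0 hM] := sum_bound; exists (1 + M); first by rewrite addr_ge0.
move=> x; rewrite (le_trans (nrmB _ _))// mulrDl mul1r lerD2l.
exact: le_trans (nrm_sum _ _ _) (hM x).
Qed.

Let S : {linear X -> X} := T \o compl_proj.

Lemma iterS_compl n x : (0 < n)%N -> iter n S x = iter n T (compl_proj x).
Proof.
case: n => // n _; elim: n => [//|n IH].
rewrite iterS IH {1}/S /= -/(iter n.+1 T _).
by rewrite compl_proj_op compl_proj_iter compl_proj_id// => j; rewrite compl_proj_ker.
Qed.

(** If z = l_j, then compl_proj x is in ker E_j = (l_j - T) X, which every limit
    at l_j kills; otherwise z is not an eigenvalue and F = 0. *)
Lemma limit_compl z F x : `|z| = 1 -> spectral_limit T z F -> F (compl_proj x) = 0.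
Proof.
move=> z1 sF; have [[j zj]|nz] := pselect (exists j, z = l j).
  have [y <-] := sl_ker (sE j) (compl_proj_ker j x).
  by rewrite -zj (sl_range y sF).
apply: (off z1); last by rewrite (sl_opE sF).
by move=> j; apply/eqP => zj; apply: nz; exists j.
Qed.

(** The means of z S are those of z T composed with compl_proj, and the latter
    kills the limit. *)
Lemma cesaro_compl z : `|z| = 1 -> forall e : R, 0 < e ->
  exists N, forall n, (N <= n)%N ->
    forall x, nrm (cesaro_mean (z \*: S) n x) <= e * nrm x.
Proof.
move=> z1 e e0; have [M M0 hM] := compl_proj_bound.
have c1 : `|z^*| = 1 by rewrite norm_conjC.
have [F sF] := spectral_limitP T_rue c1.
have e1 : 0 < e / (M + 1) by rewrite divr_gt0// ltr_wpDl.
have [N hN] := sl_erg sF e1; exists N => n Nn x.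
have -> : cesaro_mean (z \*: S) n x = cesaro_mean (z \*: T) n (compl_proj x).
  rewrite /cesaro_mean; congr (_ *: _); rewrite !big_nat; apply: eq_bigr => i /andP[i0 _].
  by rewrite !iter_scale iterS_compl.
have := hN n Nn (compl_proj x).
rewrite (limit_compl x c1 sF) subr0 conjCK => /le_trans; apply.
have : e / (M + 1) * nrm (compl_proj x) <= e / (M + 1) * ((M + 1) * nrm x).
  rewrite ler_wpM2l ?(ltW e1)// (le_trans (hM x))// ler_wpM2r ?nrm_ge0//.
  by rewrite lerDl.
by rewrite [_ * ((_ + _) * _)]mulrA divfK// gt_eqF// ltr_wpDl.
Qed.

(** S is power bounded by [iter_nonexpansive], whose lower bounds come from the
    means: with M_N of norm at most 1/2,
    |x| <= 2 |x - M_N x| = 2 |q (x - z S x)|.  Then T^m differs from S^m by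
    the sum of the l_j^m E_j. *)
Lemma op_power_bounded : power_bounded T.
Proof.
have [B B0 hB] := bounded_opP Tb.
have [M M0 hM] := compl_proj_bound.
have hS x : nrm (S x) <= B * M * nrm x.
  by rewrite -mulrA (le_trans (hB _))// ler_wpM2l.
have BM0 : 0 <= B * M by rewrite mulr_ge0.
have [||n n0 hn] := @iter_nonexpansive _ _ S _ BM0 hS.
- have one : `|1 : R[i]| = 1 by rewrite normr1.
  have [N hN] := cesaro_compl one ltr01; exists N.+1 => -[//|n] Nn x.
  have -> : iter n.+1 S x = iter n.+1 (1 \*: S) x by rewrite iter_scale expr1n scale1r.
  rewrite cesaro_rec (le_trans (nrmB _ _))// !nrmZ_nat.
  have a1 := hN n.+1 ltac:(lia) x; have a2 := hN n ltac:(lia) x.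
  rewrite !mul1r in a1 a2.
  have b1 := ler_wpM2l (ler0n R n.+1) a1; have b2 := ler_wpM2l (ler0n R n) a2.
  apply: le_trans (lerD b1 b2) _; rewrite -mulrDl ler_wpM2r ?nrm_ge0//.
  by rewrite -natr1; lra.
- move=> z /nrm_unit z1; have h2 : 0 < 2^-1 :> R by rewrite invr_gt0.
  have [N hN] := cesaro_compl z1 h2.
  have [|C C0 hC] := @cesaro_quot_bound _ _ (z \*: S) (B * M) N.+1 BM0.
    move=> x; rewrite [nrm _](nrmZ z (S x)) ((nrm_unit z).1 z1) mul1r.
    exact: hS.
  exists (2 * C); first by rewrite mulr_ge0.
  move=> x; have := hC (x - z *: S x).
  have := @cesaro_quotE _ _ (z \*: S) N.+1 x isT => /= ->.
  have := hN N.+1 (leqnSn _) x.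
  have := nrmD (x - cesaro_mean (z \*: S) N.+1 x) (cesaro_mean (z \*: S) N.+1 x).
  rewrite subrK; lra.
have [K1 K10 hK1] := sum_bound.
pose K2 := (1 + B * M) ^+ n.
have K20 : 0 <= K2 by rewrite exprn_ge0// addr_ge0.
have Sb m x : nrm (iter m S x) <= K2 * nrm x.
  have it q v : nrm (iter q (iter n S) v) <= nrm v.
    by elim: q => //= q IH; apply: le_trans (hn _) IH.
  rewrite (divn_eq m n) addnC iterD iterM.
  apply: le_trans (iter_bound BM0 hS _ _) _.
  apply: ler_pM; rewrite ?exprn_ge0 ?nrm_ge0//.
  apply: (@le_trans _ _ ((1 + B * M) ^+ (m %% n))).
    by apply: lerXn2r; rewrite ?nnegrE ?addr_ge0// lerDr.
  by rewrite ler_weXn2l// ?lerDl// ltnW// ltn_pmod.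
exists (1 + K1 + K2); first by rewrite !addr_ge0.
move=> [|m] x.
  by rewrite /= ler_peMl ?nrm_ge0// -addrA lerDl addr_ge0.
have -> : iter m.+1 T x = iter m.+1 S x + \sum_j (l j) ^+ m.+1 *: E j x.
  rewrite iterS_compl//.
  have h j q : iter q T (E j x) = (l j) ^+ q *: E j x.
    elim: q => [|q IH]; first by rewrite expr0 scale1r.
    by rewrite iterS IH linearZ/= (sl_opE (sE j)) scalerA -exprSr.
  under eq_bigr do rewrite -h.
  by rewrite -linear_sum -linearD/= subrK.
rewrite (le_trans (nrmD _ _))//.
have b1 := Sb m.+1 x.
have b2 : nrm (\sum_j l j ^+ m.+1 *: E j x) <= K1 * nrm x.
  apply: le_trans (nrm_sum _ _ _) _; apply: le_trans (hK1 x).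
  by apply: ler_sum => j _; rewrite nrmZ nrmX1 ?mul1r//; apply/nrm_unit.
have := nrm_ge0 x; lra.
Qed.

End Decomposition.
End Rotation.

(** * The ergodic Hilbert series and the ranges *)

Section Harmonic.
Variables (R : realType) (X : completeNormedModType R[i]).

Lemma series_bounded_op_cvg (E : {linear X -> X}) (u : X ^nat) :
  (exists2 M : R, 0 <= M & forall x, nrm (E x) <= M * nrm x) ->
  cvgn (series u) -> cvgn (series (E \o u)).
Proof.
move=> [M M0 hM] /cvgn_series_nrmP h; apply/cvgn_series_nrmP => e e0.
have e1 : 0 < e / (M + 1) by rewrite divr_gt0// ltr_wpDl.
have [N hN] := h _ e1; exists N => m n Nm mn.
rewrite -(linear_sum E) (le_lt_trans (hM _))//.
have := hN m n Nm mn; rewrite ltr_pdivlMr ?ltr_wpDl//.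
by apply: le_lt_trans; rewrite mulrC ler_wpM2l ?nrm_ge0// lerDl.
Qed.

Lemma harmonic_multiple_eq0 (e : X) :
  cvgn (series (fun k => (k.+1%:R^-1 : R[i]) *: e)) -> e = 0.
Proof.
move=> /cvgn_series_nrmP h; apply: contra_notP (@dvg_harmonic R) => /eqP e0.
have ne : 0 < nrm e by rewrite lt_def nrm_eq0 e0 nrm_ge0.
apply/cauchy_cvgP/cauchy_seriesP => eps eps0.
have [N hN] := h (eps * nrm e) (mulr_gt0 eps0 ne).
exists ([set n | (N <= n)%N], [set n | (N <= n)%N]); first by split; exists N.
move=> [m n] /= [Nm Nn]; have [mn|/ltnW nm] := leqP m n; last by rewrite big_geq// normr0.
rewrite ger0_norm; last by apply: sumr_ge0 => i _; exact: harmonic_ge0.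
rewrite -(ltr_pM2r ne); apply: le_lt_trans (hN m n Nm mn).
rewrite -scaler_suml nrmZ ler_wpM2r ?nrm_ge0//.
have -> : \sum_(m <= i < n) (i.+1%:R^-1 : R[i]) = ((\sum_(m <= i < n) harmonic i)%:C)%C.
  rewrite rmorph_sum; apply: eq_bigr => i _.
  by rewrite /= fmorphV/= rmorph_nat.
by rewrite nrm_real ler_norm.
Qed.

End Harmonic.

Section Assembly.
Variables (R : realType) (X : completeNormedModType R[i]).
Variables (T : {linear X -> X}) (k : nat) (l : 'I_k -> R[i]).
Variable (E : 'I_k -> {linear X -> X}).
Hypothesis sE : forall j, spectral_limit T (l j) (E j).
Hypothesis l_inj : injective l.
Hypothesis l_unit : forall j, `|l j| = 1.

Lemma range_kerE j : range (scalar_sub (l j) T) = [set x | E j x = 0].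
Proof.
apply/seteqP; split=> x /=; first by case=> y _ <-; exact: (sl_range _ (sE j)).
by move=> /(sl_ker (sE j))[y <-]; exists y.
Qed.

(** E_j maps the n-th term at z = l_j^* to E_j x / n. *)
Lemma hilbert_sum_cvg_ker j x :
  cvgn (ergodic_hilbert_sum T (l j)^* x) -> E j x = 0.
Proof.
move=> h; apply: harmonic_multiple_eq0.
have e N : ergodic_hilbert_sum T (l j)^* x N =
    series (fun n => ((l j)^* ^+ n.+1 / n.+1%:R) *: iter n.+1 T x) N.
  by rewrite /ergodic_hilbert_sum big_add1.
have {}e := funext e; rewrite e in h.
have := series_bounded_op_cvg (sl_bound (sE j)) h.
have Eit n : E j (iter n T x) = l j ^+ n *: E j x.
  elim: n => [|n IH]; first by rewrite expr0 scale1r.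
  by rewrite iterS (sl_Eop (sE j)) IH scalerA exprS.
have -> // : E j \o (fun n => ((l j)^* ^+ n.+1 / n.+1%:R) *: iter n.+1 T x) =
   (fun n => (n.+1%:R^-1 : R[i]) *: E j x).
apply/funext => n; rewrite [LHS]linearZ Eit [LHS]scalerA.
by rewrite mulrAC -exprMn conj_unit// expr1n mul1r.
Qed.

Let Y : set X := \bigcap_(j in [set: 'I_k]) [set x | E j x = 0].
Let F : X -> X := \big[comp/idfun]_(j < k) scalar_sub (l j) T.

(** A preimage x of y is corrected to compl_proj x: compl_proj commutes with T
    and fixes y. *)
Lemma factor_surj i y : Y y -> exists2 x, Y x & scalar_sub (l i) T x = y.
Proof.
move=> Yy; have [x xy] := sl_ker (sE i) (Yy i Logic.I).
exists (compl_proj E x); first by move=> j _; exact: (compl_proj_ker l_inj sE).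
have <- : compl_proj E y = y by apply: compl_proj_id => j; exact: Yy.
rewrite -xy /scalar_sub [compl_proj E (_ - _)]linearB.
by rewrite /= linearZ (compl_proj_op sE).
Qed.

(** E_j composed with the product is the scalar prod_i (l_i - l_j) = 0 times
    E_j, so the range lies in Y; conversely each factor maps Y onto Y. *)
Lemma range_prodE : range F = Y.
Proof.
have scalar_prod j : forall x, E j (F x) = (\prod_(i < k) (l i - l j)) *: E j x.
  rewrite /F; elim/big_rec2 : _ => [|i p f _ IH] x; first by rewrite scale1r.
  rewrite /= /scalar_sub linearB linearZ/= (sl_Eop (sE j)) -scalerBl IH.
  by rewrite scalerA.
apply/seteqP; split=> x.
  by case=> y _ <- j _; rewrite /= scalar_prod (bigD1 j)//= subrr mul0r scale0r.
have surj : forall y, Y y -> exists2 x, Y x & F x = y.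
  rewrite /F; elim/big_rec : _ => [|i f _ IH] y Yy; first by exists y.
  have [z Yz zy] := factor_surj i Yy; have [w Yw wz] := IH z Yz.
  by exists w => //=; rewrite wz.
by move=> /surj[w _ <-]; exists w.
Qed.

Lemma closed_ker : closed Y.
Proof.
apply: closed_bigI => j _.
have cE : continuous (E j).
  apply: bounded_linear_continuous; apply/bounded_funP => r.
  have [M M0 hM] := sl_bound (sE j).
  exists ((M%:C)%C * `|r|) => x xr; rewrite !nrmE -rmorphM/= lecR.
  rewrite (le_trans (hM x))// ler_wpM2l//.
  rewrite -lecR -!nrmE (le_trans xr)// real_ler_norm//.
  by rewrite ger0_real// (le_trans _ xr).
have -> : [set x | E j x = 0] = E j @^-1` [set 0] by [].
apply: preimage_closed => //.
exact/accessible_closed_set1/hausdorff_accessible/norm_hausdorff.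
Qed.

Lemma submod_ker : submod_closed [in Y].
Proof.
split; first by apply/mem_set => j _ /=; rewrite linear0.
move=> a u v /set_mem Yu /set_mem Yv; apply/mem_set => j _ /=.
by rewrite linearP (Yu j Logic.I) (Yv j Logic.I) scaler0 addr0.
Qed.

End Assembly.

Theorem theorem4p6 (R : realType) (X : completeNormedModType R[i])
    (T : {linear X -> X}) (k : nat) (l : 'I_k -> R[i])
    (T_bounded : bounded_op T)
    (T_rue : rotationally_uniformly_ergodic T)
    (Lambda_neq0 : peripheral_spectrum T !=set0)
    (l_inj : injective l)
    (l_enum : peripheral_spectrum T = range l)
    (l_pole : forall j : 'I_k, resolvent_pole T (l j)) :
  [/\ (forall (x : X) (z : R[i]), `|z| = 1 -> ~ peripheral_spectrum T z^* ->
         cvgn (ergodic_hilbert_sum T z x)),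
      (forall x : X,
         (forall z : R[i], `|z| = 1 -> cvgn (ergodic_hilbert_sum T z x)) <->
         (\bigcap_(j in [set: 'I_k]) range (scalar_sub (l j) T)) x) &
      [/\ submod_closed [in range (\big[comp/idfun]_(j < k) scalar_sub (l j) T)],
          closed (range (\big[comp/idfun]_(j < k) scalar_sub (l j) T)) &
          range (\big[comp/idfun]_(j < k) scalar_sub (l j) T) =
          \bigcap_(j in [set: 'I_k]) range (scalar_sub (l j) T)] ].
Proof.
have l_unit j : `|l j| = 1.
  have : range l (l j) by exists j.
  by rewrite -l_enum => -[].
have [E sE] : exists E : 'I_k -> {linear X -> X},
    forall j, spectral_limit T (l j) (E j).
  suff /boolp.choice[E hE] :
    forall j, exists F : {linear X -> X}, spectral_limit T (l j) F by exists E.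
  by move=> j; exact: spectral_limitP.
have off z : `|z| = 1 -> ~ peripheral_spectrum T z -> forall w, T w = z *: w -> w = 0.
  move=> z1 nz w Tw.
  have [Q [_ QK _]] : resolvent_set T z by apply: contrapT => h; apply: nz.
  by rewrite -(QK w) /scalar_sub Tw subrr linear0.
have off_l z : `|z| = 1 -> (forall j, z != l j) -> forall w, T w = z *: w -> w = 0.
  move=> z1 nz; apply: off => //; rewrite l_enum => -[j _ jz].
  by have := nz j; rewrite jz eqxx.
have Tpb := op_power_bounded l_inj l_unit sE T_bounded T_rue off_l.
have cvg_off z x : `|z| = 1 -> ~ peripheral_spectrum T z^* ->
    cvgn (ergodic_hilbert_sum T z x).
  move=> z1 nz; have c1 : `|z^*| = 1 by rewrite norm_conjC.
  have [F sF] := spectral_limitP T_rue c1.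
  have [|y <-] := sl_ker sF (x := x); last exact: hilbert_sum_cvg.
  by apply: (off _ c1 nz); exact: (sl_opE sF).
have rngE : \bigcap_(j in [set: 'I_k]) range (scalar_sub (l j) T) =
    \bigcap_(j in [set: 'I_k]) [set x | E j x = 0].
  by apply: eq_bigcapr => j _; exact: range_kerE.
split=> [x z|x|]; first exact: cvg_off.
- split=> [cv|rx z z1].
    rewrite rngE => j _; apply: (hilbert_sum_cvg_ker sE l_unit).
    by apply: cv; rewrite norm_conjC.
  have [nz|nz] := pselect (peripheral_spectrum T z^*); last exact: cvg_off.
  move: (nz); rewrite l_enum => -[j _ jz]; have [y _ <-] := rx j Logic.I.
  by rewrite jz; exact: hilbert_sum_cvg.
- rewrite rngE (range_prodE sE l_inj); split=> //.
    exact: submod_ker.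
  exact: closed_ker.
Qed.
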